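(* Let $k\ge 3$ be odd and let $G$ be an odd unicycle graph of girth $k$ whose Grover walk is periodic with odd period, whose unique cycle has vertices $u,u_1,\dots,u_{k-1}$ with $\deg u=4$ and $\deg u_i=2$ for $1\le i\le k-1$. Let $v_1,w_1$ be the two neighbours of $u$ off the cycle, let $t\ge1$, and suppose $v_1,\dots,v_t$ and $w_1,\dots,w_t$ are defined (as in the context) with $\deg v_1=\dots=\deg v_t=2$ and $\deg w_1=\dots=\deg w_t=2$. Then either $\deg v_{t+1}=\deg w_{t+1}=1$ or $\deg v_{t+1}=\deg w_{t+1}=2$.
   Context: Graphs are simple, connected and finite. An odd unicycle graph is a non-bipartite graph with $|V|=|E|$, i.e. a connected graph with exactly one cycle, of odd length (its girth). Grover walk: with arcs $\mathcal{A}=\{(a,b),(b,a)\mid ab\in E\}$, $o((a,b))=a$, $t((a,b))=b$, $\overline{(a,b)}=(b,a)$, the time evolution $U$ on $\mathbb{C}^{\mathcal{A}}$ has $U_{e,f}=2/\deg t(f)$ if $t(f)=o(e)$, $e\neq\bar f$; $U_{e,f}=2/\deg t(f)-1$ if $e=\bar f$; $0$ otherwise; periodic means $U^m=I$ for some $m\ge1$, the least such $m$ being the period. Set $v_0=w_0=u$; recursively, if $v_{j-1}$ ($j\ge2$) is defined and has degree 2, $v_j$ is its neighbour other than $v_{j-2}$; similarly for $w_j$. (Thus, under the hypothesis, $v_{t+1}$ and $w_{t+1}$ are well defined.) *)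

(* Defs.v *)
From HB Require Import structures.
From mathcomp Require Import all_boot all_order all_algebra.
Set Implicit Arguments. Unset Strict Implicit. Unset Printing Implicit Defensive.
Import GRing.Theory Num.Theory.
Local Open Scope ring_scope.

Section Graph.
Variables (T : finType) (e : rel T).

Definition simple_graph : Prop := symmetric e /\ irreflexive e.
Definition connected_graph : Prop := forall x y : T, connect e x y.

Definition deg (x : T) : nat := #|[pred y | e x y]|.

Definition n_arcs : nat := #|[pred p : T * T | e p.1 p.2]|.
Definition n_edges : nat := (n_arcs %/ 2)%N.

Definition bipartite : Prop :=
  exists f : T -> bool, forall x y, e x y -> f x != f y.

Definition odd_unicycle : Prop :=
  [/\ simple_graph, connected_graph, ~ bipartite & n_edges = #|T|].

Definition arc := {p : T * T | e p.1 p.2}.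
Definition arc_o (a : arc) : T := (val a).1.
Definition arc_t (a : arc) : T := (val a).2.

Definition grover_entry (a f : arc) : rat :=
  if arc_t f == arc_o a then
    (if (arc_o f == arc_t a) then (2 / (deg (arc_t f))%:R - 1)
     else 2 / (deg (arc_t f))%:R)
  else 0.

Definition grover_matrix : 'M[rat]_(#|{: arc}|) :=
  \matrix_(i, j) grover_entry (enum_val i) (enum_val j).

Definition grover_period (p : nat) : Prop :=
  [/\ (0 < p)%N, grover_matrix ^+ p = 1 &
      forall m : nat, (0 < m < p)%N -> grover_matrix ^+ m <> 1].

End Graph.

(* Main.v *)
(** Put M = 2 D^-1 A and let U be the Grover walk. The incidence matrix of arcs and terminal
    vertices intertwines M^T with U + U^-1, so if U^p = 1 every eigenvalue of M is z + 1/z for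
    a root of unity z, and g = det (x - M) has integer coefficients. Let K be M with the row
    and column of u removed, kappa = det (x - K), and let r be the indicator row vector of
    the neighbours of u. Expanding at u,
      g = kappa (x - \sum_m nu_m x^-(m+1)),   nu_m = r K^m r^T / 2.
    As |V| = |E|, removing u leaves a forest, so kappa has the parity of its degree, and only
    the walks from u_1 to u_(k-1) along the cycle contribute to nu_m for m odd. The
    corresponding part of g is -kappa (x^-(k-1) + ...) with an integer monic series, so
    kappa, and then the other nu_m, are integers.
    Finally nu_(2t) = 1 / deg v_(t+1) + 1 / deg w_(t+1) modulo the integers, because K is
    conjugate to its transpose by D and all vertices met earlier have degree 2; and
    1/a + 1/b is an integer only for a = b = 1 and a = b = 2. *)
Require Import Defs.
From HB Require Import structures.
From mathcomp Require Import all_boot all_order all_algebra all_field perm zify ring.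
Set Implicit Arguments. Unset Strict Implicit. Unset Printing Implicit Defensive.
Import GRing.Theory Num.Theory.

(** * Integrality of the characteristic polynomial *)

Section Integrality.
Local Open Scope ring_scope.

(** The coefficients are polynomials in the eigenvalues, hence algebraic integers, and a rational
    algebraic integer is an integer. *)
Lemma char_poly_polyOver_int n (M : 'M[rat]_n) :
  (forall z : algC, eigenvalue (map_mx ratr M) z -> z \in Aint) ->
  char_poly M \is a polyOver Num.int.
Proof.
move=> eigM; pose p : {poly algC} := char_poly (map_mx ratr M).
have [s Dp] := closed_field_poly_normal p.
have p_mon : p \is monic by apply: char_poly_monic.
rewrite (monicP p_mon) scale1r in Dp.
have pAint : p \is a polyOver Aint.
  rewrite Dp big_seq; apply: rpred_prod => z sz; rewrite polyOverXsubC eigM //.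
  by rewrite eigenvalue_root_char -/p Dp root_prod_XsubC.
apply/polyOverP=> i.
have Dpi : p`_i = ratr (char_poly M)`_i by rewrite /p -map_char_poly coef_map.
rewrite -Cint_rat; apply: Cint_rat_Aint; first by rewrite Crat_rat.
by rewrite -Dpi (polyOverP pAint).
Qed.

Lemma eigenvalue_expr1 n (U : 'M[algC]_n) p z :
  (0 < p)%N -> U ^+ p = 1 -> eigenvalue U z -> z ^+ p = 1.
Proof.
move=> p0 Up /eigenvalueP[v vU nz_v].
have vUm m : v *m U ^+ m = z ^+ m *: v.
  elim: m => [|m IH]; first by rewrite mulmx1 scale1r.
  by rewrite exprSr mulmxA IH -scalemxAl vU scalerA -exprSr.
have := vUm p; rewrite Up mulmx1 => /eqP; rewrite -subr_eq0 -{1}[v]scale1r -scalerBl.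
by rewrite scaler_eq0 (negPf nz_v) orbF subr_eq0 => /eqP.
Qed.

(* If v is an eigenvector of A for x, then y = v K satisfies
   y (U - z) (U - 1/z) = 0 with z + 1/z = x, so z or 1/z is an eigenvalue of U. *)
Lemma eigenvalue_intertwine_Aint m n (U : 'M[algC]_m) (K : 'M_(n, m)) (A : 'M_n) p x :
  (0 < p)%N -> U ^+ p = 1 -> row_free K ->
  K *m U *m U = A *m K *m U - K -> eigenvalue A x -> x \in Aint.
Proof.
move=> p0 Up freeK KUU /eigenvalueP[v vA nz_v].
(* [z] and [z'] are the two roots of [X^2 - x X + 1]. *)
pose d := sqrtC (x ^+ 2 - 4); pose z := (x + d) / 2; pose z' := (x - d) / 2.
have two0 : (2 : algC) != 0 by rewrite pnatr_eq0.
have szz : z + z' = x.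
  by rewrite /z /z' -mulrDl addrACA subrr addr0 -mulr2n -(mulr_natr x) mulfK.
have pzz : z * z' = 1.
  have -> : z * z' = (x ^+ 2 - d ^+ 2) / (2 * 2).
    by rewrite /z /z' mulf_div subr_sqr [(x + d) * _]mulrC.
  by rewrite sqrtCK opprB addrC subrK -natrM divff ?pnatr_eq0.
have Aint_of y y' : y * y' = 1 -> y ^+ p = 1 -> y + y' \in Aint.
  move=> yy' yp; have y'p : y' ^+ p = 1.
    by rewrite -[LHS]mul1r -{1}yp -exprMn yy' expr1n.
  by apply: rpredD; apply: (@Aint_unity_root p) => //; apply/unity_rootP.
pose y := v *m K.
have nz_y : y != 0.
  apply: contra nz_v => /eqP y0; apply/eqP.
  by apply: (row_free_inj freeK); rewrite mul0mx.
have yUU : y *m U *m U = x *: (y *m U) - y.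
  rewrite /y -[v *m K *m U]mulmxA -[_ *m U]mulmxA KUU mulmxBr !mulmxA vA.
  by rewrite -!scalemxAl.
have [y0 | nz_y'] := eqVneq (y *m U - z *: y) 0.
  rewrite -szz Aint_of //; apply: (eigenvalue_expr1 p0 Up).
  by apply/eigenvalueP; exists y => //; apply/eqP; rewrite -subr_eq0 y0.
(* Otherwise [y U - z y] is a nonzero left eigenvector of [U] for [z']. *)
rewrite -szz addrC Aint_of //; first by rewrite mulrC.
apply: (eigenvalue_expr1 p0 Up); apply/eigenvalueP; exists (y *m U - z *: y) => //.
rewrite mulmxBl yUU -scalemxAl scalerBr scalerA [z' * z]mulrC pzz scale1r.
by rewrite -szz scalerDl addrAC [z *: _ + _]addrC addrK.
Qed.

End Integrality.

(** * The Grover walk and the random walk on the vertices *)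

Section Grover.
Variables (T : finType) (e : rel T) (n : nat) (tau : 'I_n -> T).
Hypothesis tauB : bijective tau.
Hypothesis esym : symmetric e.
Hypothesis deg_gt0 : forall x, (0 < deg e x)%N.
Local Open Scope ring_scope.
Local Notation A := {: Defs.arc e}.

(** Twice the transition matrix of the simple random walk. The vertex order [tau] is left free so
    that a chosen root can be put first. *)
Definition walk_mx : 'M[rat]_n :=
  \matrix_(i, j) ((e (tau i) (tau j))%:R * (2 / (deg e (tau i))%:R)).

Let Kt : 'M[rat]_(n, #|A|) := \matrix_(i, j) (arc_t (enum_val j) == tau i)%:R.
Let Ko : 'M[rat]_(n, #|A|) := \matrix_(i, j) (arc_o (enum_val j) == tau i)%:R.

Lemma big_arc (F : A -> rat) :
  \sum_(i < #|A|) F (enum_val i) = \sum_(a : A) F a.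
Proof.
by rewrite (reindex (@enum_val _ A)) //; exists enum_rank => a _;
  rewrite ?enum_rankK ?enum_valK.
Qed.

Lemma card_arc_o x : #|[pred a : Defs.arc e | arc_o a == x]| = deg e x.
Proof.
rewrite -(card_in_image (f := @arc_t _ e)); last first.
  move=> [[a1 a2] /= ea] [[b1 b2] /= eb]; rewrite !inE /arc_o /arc_t /=.
  by move=> /eqP Da /eqP Db E; apply/val_inj; rewrite /= E Da Db.
apply: eq_card => y; apply/imageP/idP => [[[[a1 a2] /= ea]]|].
  by rewrite !inE /arc_o /arc_t /= => /eqP<- ->.
by rewrite inE => exy; exists (Sub (x, y) exy); rewrite ?inE /arc_o /arc_t SubK.
Qed.

(** From an arc [f], amplitude reaches an arc ending at x only through the arc from the end of [f]
    to x, with weight 2/deg. The correction -1 for reflection occurs exactly when x is the origin of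
    [f], whence [Ko]. *)
Lemma intertwine_in : Kt *m grover_matrix e = walk_mx^T *m Kt - Ko.
Proof.
apply/matrixP=> i j; rewrite !mxE.
set f := enum_val j.
transitivity (\sum_(a : A) (arc_t a == tau i)%:R * grover_entry a f).
  by rewrite -big_arc; apply: eq_bigr => a _; rewrite !mxE.
have [s sK Ks] := tauB.
have -> : \sum_k walk_mx^T i k * Kt k j =
          (e (arc_t f) (tau i))%:R * (2 / (deg e (arc_t f))%:R).
  rewrite (bigD1 (s (arc_t f))) //= big1 ?addr0.
    by rewrite !mxE Ks eqxx mulr1.
  move=> k neq; rewrite !mxE -/f; case: eqP => [E|_]; last by rewrite mulr0.
  by case/eqP: neq; rewrite E sK.
rewrite -/f.
have [ei|nei] := boolP (e (arc_t f) (tau i)).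
  pose a0 : A := Sub (arc_t f, tau i) ei.
  have o0 : arc_o a0 = arc_t f by rewrite /arc_o SubK.
  have t0 : arc_t a0 = tau i by rewrite /arc_t SubK.
  rewrite (bigD1 a0) //= big1 ?addr0.
    rewrite t0 eqxx !mul1r /grover_entry o0 t0 eqxx.
    by case: eqP => _; rewrite ?subr0.
  move=> a neq; rewrite /grover_entry.
  case: eqP => [ta|_]; last by rewrite mul0r.
  case: eqP => [oa|_]; last by rewrite mulr0.
  case/eqP: neq; apply: val_inj; rewrite /= /a0.
  by rewrite [val a]surjective_pairing -/(arc_o a) -/(arc_t a) ta -oa.
rewrite mul0r sub0r big1 => [|a _].
  suff /negPf-> : arc_o f != tau i by rewrite oppr0.
  by apply: contra nei => /eqP<-; rewrite esym; apply: (valP f).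
case: eqP => [ta|_]; last by rewrite mul0r.
rewrite /grover_entry; case: eqP => [oa|_]; last by rewrite mulr0.
by case/negP: nei; rewrite oa -ta; apply: (valP a).
Qed.

(** The arcs leaving the end of [f] receive 2/deg each, 2 altogether, less 1 on the reversed arc.
    With [intertwine_in] this yields the quadratic relation [Kt U U = M^T Kt U - Kt]. *)
Lemma intertwine_out : Ko *m grover_matrix e = Kt.
Proof.
apply/matrixP=> i j; rewrite !mxE.
set f := enum_val j.
transitivity (\sum_(a : A) (arc_o a == tau i)%:R * grover_entry a f).
  by rewrite -big_arc; apply: eq_bigr => a _; rewrite !mxE.
have [tf|ntf] := eqVneq (arc_t f) (tau i); last first.
  rewrite big1 // => a _; case: eqP => [oa|_]; last by rewrite mul0r.
  by rewrite /grover_entry oa (negPf ntf) mulr0.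
have ef : e (arc_t f) (arc_o f) by rewrite esym; apply: (valP f).
pose a0 : A := Sub (arc_t f, arc_o f) ef.
have o0 : arc_o a0 = arc_t f by rewrite /arc_o SubK.
have t0 : arc_t a0 = arc_o f by rewrite /arc_t SubK.
transitivity (\sum_(a : A | arc_o a == tau i) (2 / (deg e (tau i))%:R - (a == a0)%:R) : rat).
  rewrite [RHS]big_mkcond /=; apply: eq_bigr => a _.
  case: eqP => [oa|_]; last by rewrite mul0r.
  rewrite mul1r /grover_entry tf oa eqxx.
  have -> : (arc_o f == arc_t a) = (a == a0).
    apply/eqP/eqP => [ta|->]; last by rewrite t0.
    apply: val_inj; rewrite /= [val a]surjective_pairing -/(arc_o a) -/(arc_t a).
    by rewrite ta oa tf.
  by case: (a == a0); rewrite ?subr0.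
rewrite sumrB sumr_const card_arc_o (bigD1 a0) /=; last by rewrite o0 tf.
rewrite eqxx big1 => [|a /andP[_ /negPf->]] //; rewrite addr0 -[_ *+ deg _ _]mulr_natr.
by rewrite divfK ?pnatr_eq0 -?lt0n // -[2]/(1 + 1) addrK.
Qed.

(** Choosing one incoming arc per vertex gives a right inverse. *)
Lemma row_free_Kt : row_free Kt.
Proof.
have inA x : {a : A | arc_t a == x}.
  apply: sigW; have /card_gt0P[y] := deg_gt0 x; rewrite inE esym => eyx.
  by exists (Sub (y, x) eyx); rewrite /arc_t SubK.
apply/row_freeP.
exists (\matrix_(j, i) (j == enum_rank (sval (inA (tau i))))%:R).
apply/matrixP=> i i'; rewrite !mxE.
rewrite (bigD1 (enum_rank (sval (inA (tau i'))))) //= big1 => [|j /negPf nj].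
  rewrite !mxE eqxx mulr1 addr0 enum_rankK.
  by case: (inA _) => a /= /eqP->; rewrite (inj_eq (bij_inj tauB)) eq_sym.
by rewrite !mxE nj mulr0.
Qed.

Lemma char_poly_walk_int p : grover_period e p ->
  char_poly walk_mx \is a polyOver Num.int.
Proof.
case=> p0 Up _.
have <- : char_poly walk_mx^T = char_poly walk_mx.
  rewrite /char_poly -(det_tr (char_poly_mx walk_mx)) /char_poly_mx.
  by rewrite linearB /= tr_scalar_mx map_trmx.
apply: char_poly_polyOver_int => z.
pose U : 'M[algC]_(#|A|) := map_mx ratr (grover_matrix e).
apply: (@eigenvalue_intertwine_Aint _ _ U (map_mx ratr Kt) _ p) => //.
- have mapX m : U ^+ m = map_mx ratr (grover_matrix e ^+ m).
    elim: m => [|m IH]; first by rewrite !expr0 map_mx1.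
    by rewrite !exprS IH map_mxM.
  by rewrite mapX Up map_mx1.
- by rewrite row_free_map row_free_Kt.
rewrite -!map_mxM -map_mxB; congr (map_mx _ _).
by rewrite {1}intertwine_in mulmxBl intertwine_out.
Qed.

End Grover.

(** * Characteristic polynomials of bordered and of bipartite matrices *)

Section CharPoly.
Local Open Scope ring_scope.

(** Right multiplication by the block matrix with rows [(char_poly K, 0)] and [(adj (x - K) c, 1)]
    clears the lower left block. Comparing determinants and cancelling [char_poly K] avoids
    inverting x - K. *)
Lemma char_poly_bordered (F : fieldType) n (b : 'rV[F]_n) (c : 'cV_n) (K : 'M_n) :
  char_poly (block_mx 0 b c K) =
  'X * char_poly K -
  (map_mx polyC b *m \adj (char_poly_mx K) *m map_mx polyC c) 0 0.
Proof.
set KX := char_poly_mx K; set bX := map_mx polyC b; set cX := map_mx polyC c.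
have Dblock : char_poly_mx (block_mx 0 b c K) = block_mx 'X%:M (- bX) (- cX) KX.
  rewrite /char_poly_mx map_block_mx map_mx0 (scalar_mx_block 1 n).
  by rewrite opp_block_mx add_block_mx subr0 !sub0r.
have nz_K : char_poly K != 0 by apply: monic_neq0 (char_poly_monic K).
apply: (mulIf nz_K).
have <- : \det (block_mx ((char_poly K)%:M : 'M_1) 0 (\adj KX *m cX) 1%:M) = char_poly K.
  by rewrite det_lblock det1 mulr1 det_scalar1.
rewrite {1}/char_poly Dblock -det_mulmx mulmx_block mul_mx_scalar.
rewrite !mulmx0 !mulmx1 !add0r (mulmxA KX) mul_mx_adj mul_mx_scalar mul_scalar_mx.
rewrite scalerN addNr.
rewrite det_ublock det_mx11 !mxE eqxx mulr1n det_lblock det1 mulr1 det_scalar1.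
rewrite [char_poly K * 'X]mulrC; congr (('X * _ + _) * _).
have : (- bX *m (\adj KX *m cX)) 0 0 = - (bX *m \adj KX *m cX) 0 0.
  by rewrite mulmxA !mulNmx mxE.
by rewrite !mxE.
Qed.

(** This is the expansion of [adj (x - K)] as [char_poly K] times the series of all [K^i x^-(i+1)],
    read coefficientwise without power series. *)
Lemma coef_mul_adj_char_poly (F : fieldType) n (r : 'rV[F]_n) (c : 'cV_n) (K : 'M_n) j L :
  (n <= j + L)%N ->
  ((map_mx polyC r *m \adj (char_poly_mx K) *m map_mx polyC c) 0 0)`_j =
  \sum_(i < L) (char_poly K)`_(j.+1 + i) * (r *m K ^+ i *m c) 0 0.
Proof.
move=> leL; set a := map_mx polyC r *m _.
pose co j := \row_i (a 0 i)`_j.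
have -> : ((a *m map_mx polyC c) 0 0)`_j = (co j *m c) 0 0.
  rewrite !mxE coef_sum; apply: eq_bigr => i _.
  by rewrite !mxE coefMC.
have aK : a *m char_poly_mx K = char_poly K *: map_mx polyC r.
  by rewrite -mulmxA mul_adj_mx mul_mx_scalar.
have rec l : co l = (char_poly K)`_l.+1 *: r + co l.+1 *m K.
  apply/rowP=> i; have /rowP/(_ i)/(congr1 (fun p : {poly F} => p`_l.+1)) := aK.
  rewrite /char_poly_mx mulmxBr mul_mx_scalar !mxE coefB coefXM coefMC => <-.
  rewrite coef_sum -[LHS](subrK ((\sum_j0 a 0 j0 * (map_mx polyC K) j0 i)`_l.+1)).
  rewrite coef_sum; congr (_ + _); apply: eq_bigr => k _.
  by rewrite !mxE coefMC.
have unroll l m : co l =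
    \sum_(i < m) (char_poly K)`_(l.+1 + i) *: (r *m K ^+ i) + co (l + m)%N *m K ^+ m.
  elim: m => [|m IH]; first by rewrite big_ord0 add0r addn0 mulmx1.
  rewrite IH big_ord_recr /= -addrA; congr (_ + _).
  rewrite [co (l + m)%N]rec mulmxDl -scalemxAl -mulmxA -[K *m _]exprS addnS.
  by rewrite addSn.
(* [B] exceeds every degree in [a], so the remainder of the unrolled recursion vanishes. *)
pose B := (\max_i size (a 0%R i))%N.
have co_big l : (B <= l)%N -> co l = 0.
  move=> lel; apply/rowP=> i; rewrite [LHS]mxE [RHS]mxE nth_default //.
  by apply: leq_trans lel; exact: (leq_bigmax (F := fun i => size (a 0 i)) i).
rewrite (unroll j (L + B)%N) co_big ?mul0mx ?addr0; last by rewrite addnA leq_addl.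
(* The terms from L on involve coefficients of [char_poly K] beyond its degree n. *)
rewrite big_split_ord /= [X in _ + X]big1 ?addr0; last first.
  move=> i _; rewrite nth_default ?scale0r // size_char_poly addSn ltnS.
  by rewrite addnA (leq_trans leL) ?leq_addr.
rewrite mulmx_suml summxE; apply: eq_bigr => i _.
by rewrite -scalemxAl mxE.
Qed.

(* Conjugating by the diagonal matrix of signs turns K into -K. *)
Lemma sign_conj_mx (F : fieldType) n (K : 'M[F]_n) (f : 'I_n -> bool) :
  (forall i j, K i j != 0 -> f i != f j) ->
  let S := diag_mx (\row_i (-1) ^+ f i) in S *m K *m S = - K.
Proof.
move=> fK S; apply/matrixP=> i j; rewrite mul_diag_mx mul_mx_diag !mxE.
have [->|/fK] := eqVneq (K i j) 0; first by rewrite mulr0 mul0r oppr0.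
by case: (f i) (f j) => [] [] //= _; rewrite ?(expr0, expr1, mulN1r, mul1r, mulr1, mulrN1).
Qed.

Lemma sign_mx_sqr (F : fieldType) n (f : 'I_n -> bool) :
  let S := diag_mx (\row_i (-1) ^+ f i) : 'M[F]_n in S *m S = 1%:M.
Proof.
move=> S; apply/matrixP=> i j; rewrite mul_mx_diag !mxE.
by case: eqVneq => [->|_]; rewrite ?mul0r // -signr_addb addbb.
Qed.

(** Conjugation by signs turns [K] into [-K], so the characteristic polynomial kappa satisfies
    kappa(-x) = (-1)^n kappa(x). *)
Lemma char_poly_bipartite (n : nat) (K : 'M[rat]_n) (f : 'I_n -> bool) l :
  (forall i j, K i j != 0 -> f i != f j) ->
  (l <= n)%N -> odd l -> (char_poly K)`_(n - l) = 0.
Proof.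
move=> fK len oddl.
pose S : 'M[rat]_n := diag_mx (\row_i (-1) ^+ f i).
have SKS : S *m K *m S = - K := sign_conj_mx fK.
have SS : S *m S = 1%:M := sign_mx_sqr _ f.
have signC m : (-1) ^+ m = ((-1) ^+ m)%:P :> {poly rat} by rewrite polyC_exp polyCN.
have coefNX m i : ((- 'X : {poly rat}) ^+ m)`_i = (-1) ^+ m * (i == m)%:R.
  by rewrite -scaleN1r exprZn coefZ coefXn.
have coefN (p : {poly rat}) i : (p \Po (- 'X))`_i = (-1) ^+ i * p`_i.
  rewrite comp_polyE coef_sum.
  have [ltip|leip] := ltnP i (size p).
    rewrite (bigD1 (Ordinal ltip)) //= big1 ?addr0.
      by rewrite coefZ coefNX eqxx mulr1 mulrC.
    move=> m nm; rewrite coefZ coefNX.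
    by rewrite -val_eqE /= eq_sym in nm; rewrite (negPf nm) !mulr0.
  rewrite nth_default // mulr0 big1 // => m _.
  by rewrite coefZ coefNX gtn_eqF ?mulr0 // (leq_trans (ltn_ord m)).
have : char_poly K \Po (- 'X) = (-1) ^+ n * char_poly K.
  rewrite /char_poly -det_map_mx.
  have -> : map_mx (comp_poly (- 'X)) (char_poly_mx K) =
     - (map_mx polyC S *m char_poly_mx K *m map_mx polyC S).
    rewrite /char_poly_mx mulmxBr mulmxBl -!map_mxM SKS mul_mx_scalar -scalemxAl.
    rewrite -map_mxM SS map_mx1 scalemx1 map_mxN opprK opprD.
    apply/matrixP=> i j; rewrite !mxE rmorphB /= rmorphMn /= comp_polyX comp_polyC.
    by rewrite mulNrn.
  rewrite -scaleN1r detZ !det_mulmx mulrAC -[X in _ = _ * X]mul1r; congr (_ * (_ * _)).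
  by rewrite -det_mulmx -map_mxM SS map_mx1 det1.
move/(congr1 (fun p : {poly rat} => p`_(n - l))); rewrite coefN.
rewrite signC coefCM => /eqP.
rewrite -[_ ^+ (n - l)]signr_odd -[_ ^+ n]signr_odd oddB // oddl addbT.
by case: (odd n) => /=; rewrite ?expr0 ?expr1 ?mul1r ?mulN1r ?[- _ == _]eq_sym -?addr_eq0 -?mulr2n
  ?mulrn_eq0 /= => /eqP.
Qed.

End CharPoly.

(** * Integrality from an even power series *)

Section Arithmetic.
Local Open Scope ring_scope.

(* Reading the identity G = K (1 - y^2 nu) of power series in y with K even:
   the odd part of G determines K, and then the even part determines nu. *)
Lemma even_coef_int (K G nu : nat -> rat) k t :
  (forall l, G l \is a Num.int) ->
  K 0%N = 1 -> (forall l, odd l -> K l = 0) ->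
  (forall m, (m <= k + t.*2)%N -> G m.+2 = K m.+2 - \sum_(i < m.+1) K (m - i)%N * nu i) ->
  odd k -> (3 <= k)%N ->
  (forall m, odd m -> nu m \is a Num.int) ->
  (forall m, odd m -> (m < k - 2)%N -> nu m = 0) -> nu (k - 2)%N = 1 ->
  forall m, ~~ odd m -> (m <= t.*2)%N -> nu m \is a Num.int.
Proof.
move=> Gint K0 Kodd rec oddk k3 nu_int nu_0 nu_1.
have oddk2 : odd (k - 2) by rewrite oddB ?oddk // ltnW.
have Kint l : (l <= t.*2.+2)%N -> K l \is a Num.int.
  elim/ltn_ind: l => l IH lel.
  have [/Kodd-> // | evl] := boolP (odd l).
  (* At this index the term i = k - 2 is exactly [K l], and [K m.+2] vanishes because m is odd. The
     other surviving terms have odd i > k - 2 and involve [K (m - i)] with m - i < l. *)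
  pose m := (k - 2 + l)%N.
  have oddm : odd m by rewrite oddD oddk2 (negPf evl).
  have lem : (m <= k + t.*2)%N.
    by rewrite /m -(leq_add2r 2) addnAC subnK ?(ltnW k3) // -addnA leq_add2l addn2.
  have ltm : (k - 2 < m.+1)%N by rewrite ltnS leq_addr.
  have := rec m lem; rewrite Kodd /= ?oddm // sub0r (bigD1 (Ordinal ltm)) //=.
  rewrite nu_1 mulr1 {1}/m addKn; set S := \sum_(i | _) _ => GE.
  have -> : K l = - G m.+2 - S by rewrite GE opprK addrK.
  rewrite rpredB ?rpredN // rpred_sum // => -[i /= lti].
  rewrite -val_eqE /= => neq_i; rewrite ltnS in lti.
  have [oddi|evi] := boolP (odd i); last first.
    by rewrite Kodd ?mul0r // oddB // oddm (negPf evi).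
  case: (ltngtP i (k - 2)%N) neq_i => // [lt_i|gt_i] _.
    by rewrite nu_0 ?mulr0.
  apply: rpredM; last exact: nu_int.
  apply: IH; last first.
    apply: leq_trans lel; apply: leq_trans (leq_sub2l m (ltnW gt_i)) _.
    by rewrite /m addKn.
  by rewrite -(ltn_add2r i) subnK // /m addnC ltn_add2l.
move=> m; elim/ltn_ind: m => m IH evm lem.
have lem' : (m <= k + t.*2)%N by apply: leq_trans lem (leq_addl _ _).
(* For even m the last term is [nu m], since [K 0 = 1]; the terms with odd i vanish because m - i is
   odd. *)
have := rec m lem'; rewrite big_ord_recr /= subnn K0 mul1r; set S := \sum_(i < m) _ => GE.
have -> : nu m = K m.+2 - G m.+2 - S by rewrite GE subKr [S + _]addrC addrK.
rewrite rpredB ?rpredB ?Kint ?rpred_sum // => -[i /= lti] _.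
have [oddi|evi] := boolP (odd i).
  by rewrite Kodd ?mul0r // oddB ?(ltnW lti) // (negPf evm) oddi.
apply: rpredM; last by apply: IH; rewrite // (leq_trans (ltnW lti)).
by apply: Kint; rewrite (leq_trans (leq_subr _ _)) // (leq_trans lem) // ltnW.
Qed.

End Arithmetic.

(** * Orientation of a unicyclic graph towards its cycle *)

Section Unicycle.
Variables (T : finType) (e : rel T).

Lemma distance_exists (C : pred T) (z : T) :
  connected_graph e -> C z ->
  exists d : T -> nat, (forall x, C x -> d x = 0) /\
    forall x, ~~ C x -> exists y, e x y /\ d x = (d y).+1.
Proof.
move=> conn Cz.
pose P x n := [exists p : n.-tuple T, path e x p && C (last x p)].
have exP x : exists n, P x n.
  have /connectP[p ep Dz] := conn x z.
  by exists (size p); apply/existsP; exists (in_tuple p); rewrite ep -Dz.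
exists (fun x => ex_minn (exP x)); split=> [x Cx | x nCx].
  case: ex_minnP => n _ min_n; apply/eqP; rewrite -leqn0 min_n //.
  by apply/existsP; exists [tuple].
case: ex_minnP => n Pn min_n; case/existsP: Pn => p.
case: n p min_n => [|n] p min_n; first by rewrite tuple0 /= (negPf nCx).
case/tupleP: p => y p /= /andP[/andP[exy ep] Cl].
exists y; split=> //; case: ex_minnP => m /existsP[q /andP[eq Cq]] min_m.
congr _.+1; apply/eqP; rewrite eqn_leq; apply/andP; split.
  rewrite -ltnS; apply: min_n; apply/existsP; exists [tuple of y :: q].
  by rewrite /= exy eq.
by apply: min_m; apply/existsP; exists p; rewrite ep.
Qed.

Lemma deg2_adj x a b y : deg e x = 2 -> e x a -> e x b -> a != b -> e x y ->
  (y == a) || (y == b).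
Proof.
move=> dx ea eb ab ey; apply/norP => -[ya yb].
have : 3 <= deg e x.
  apply/card_geqP; exists [:: y; a; b]; split=> //=.
    by rewrite !inE negb_or ya yb ab.
  by move=> v; rewrite !inE => /or3P[] /eqP->.
by rewrite dx.
Qed.

Lemma deg2_adjE x a b : deg e x = 2 -> e x a -> e x b -> a != b -> e x =1 pred2 a b.
Proof.
move=> dx ea eb ab y; apply/idP/idP => [/(deg2_adj dx ea eb ab) // | ].
by case/orP=> /eqP->.
Qed.

Hypothesis esym : symmetric e.

(* Since |E| = |V|, the |V| edges {x, nxt x} are all the edges. *)
Lemma functional_edges (nxt : T -> T) :
  n_edges e = #|T| -> irreflexive e -> (forall x, e x (nxt x)) ->
  (forall x, nxt (nxt x) != x) ->
  forall x y, e x y -> (y == nxt x) || (x == nxt y).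
Proof.
move=> edges eirr enxt nxt2 x y exy; apply/norP => -[nyx nxy].
pose A := [set p : T * T | e p.1 p.2].
(* [S1] and [S2] hold the two orientations of the edges {z, nxt z}. They are disjoint as [nxt] has
   no 2-cycle, so one further edge would make 2|V| + 2 arcs. *)
pose S1 := [set (z, nxt z) | z in [set: T]].
pose S2 := [set (nxt z, z) | z in [set: T]].
have S12 : [disjoint S1 & S2].
  apply/pred0P=> -[a b] /=; apply/negP=> /andP[/imsetP[a' _ [-> ->]] /imsetP[b' _ [-> E]]].
  by case/eqP: (nxt2 b').
have cS1 : #|S1| = #|T| by rewrite card_imset ?cardsT // => z1 z2 [].
have cS2 : #|S2| = #|T| by rewrite card_imset ?cardsT // => z1 z2 [].
have xyN p q : p != nxt q -> q != nxt p -> (p, q) \notin S1 :|: S2.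
  move=> npq nqp; rewrite inE negb_or; apply/andP; split.
    by apply/imsetP=> -[z _ [Dp Dq]]; rewrite Dq Dp eqxx in nqp.
  by apply/imsetP=> -[z _ [Dp Dq]]; rewrite Dp Dq eqxx in npq.
have sub : [set (x, y); (y, x)] :|: (S1 :|: S2) \subset A.
  apply/subsetP=> -[a b]; rewrite !inE => /or3P[/orP[]||] /=.
  - by move/eqP=> [-> ->].
  - by move/eqP=> [-> ->]; rewrite esym.
  - by case/imsetP=> z _ [-> ->].
  by case/imsetP=> z _ [-> ->]; rewrite esym.
have := subset_leq_card sub; rewrite cardsU (_ : _ :&: _ = set0); last first.
  apply/setP=> -[a b]; rewrite in_setI in_set0; apply/negP => /andP[].
  by rewrite !inE => /orP[] /eqP[-> ->]; apply/negP; rewrite -in_setU xyN.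
rewrite cards0 subn0 cards2 cardsU disjoint_setI0 // cards0 subn0 cS1 cS2.
have -> : (x, y) != (y, x).
  by apply: contraTneq exy => -[-> _]; rewrite eirr.
rewrite addnn /= => leA; have := leq_div2r 2 leA.
rewrite -(mul2n #|T|) -[2 in X in X <= _]muln1 -mulnDr mulKn //.
suff -> : #|A| = n_arcs e by rewrite -/(n_edges e) edges ltnn.
by rewrite /n_arcs cardsE.
Qed.

Variables (k : nat) (c : nat -> T).
Hypotheses (k3 : 3 <= k) (c_inj : {in [pred i | i < k] &, injective c}).
Hypothesis c_edge : forall i, i < k -> e (c i) (c (i.+1 %% k)).
Let cs := mkseq c k.

Lemma uniq_cs : uniq cs. Proof. exact/mkseq_uniqP. Qed.

Lemma index_cs i : i < k -> index (c i) cs = i.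
Proof. by move=> lt_i; rewrite -(nth_mkseq (c 0) c lt_i) index_uniq ?size_mkseq ?uniq_cs. Qed.

Lemma mem_cs i : i < k -> c i \in cs.
Proof. by move=> lt_i; apply: map_f; rewrite mem_iota. Qed.

Lemma csP x : reflect (exists2 i, i < k & x = c i) (x \in cs).
Proof.
apply: (iffP mapP) => [[i]|[i lt_i ->]]; last by exists i; rewrite ?mem_iota.
by rewrite mem_iota => lt_i; exists i.
Qed.

(** [nxt] runs around the cycle and, off it, steps along a shortest path towards it. It never
    backtracks: on the cycle because k >= 3, off it because [d] drops or the cycle, once entered, is
    never left. *)
Lemma unicycle_orientation : simple_graph e -> connected_graph e -> n_edges e = #|T| ->
  exists nxt : T -> T, exists d : T -> nat,
  [/\ forall x, e x (nxt x),
      forall i, i < k -> nxt (c i) = c (i.+1 %% k),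
      forall i, i < k -> d (c i) = 0,
      forall x, x \notin cs -> d x = (d (nxt x)).+1 &
      forall x y, e x y -> (y == nxt x) || (x == nxt y)].
Proof.
move=> [_ eirr] conn edges.
have k0 : 0 < k by apply: leq_trans k3.
have [d [dC dN]] := distance_exists (C := mem cs) conn (mem_cs k0).
have exN x : exists y, e x y /\
    if x \in cs then y = c ((index x cs).+1 %% k) else d x = (d y).+1.
  have [/csP[i lt_i ->]|/dN[y Dy]] := boolP (x \in cs); last by exists y.
  by exists (c (i.+1 %% k)); rewrite index_cs //; split=> //; apply: c_edge.
have [nxt Dnxt] := fin_all_exists exN.
have nxtC i : i < k -> nxt (c i) = c (i.+1 %% k).
  by move=> lt_i; have [_] := Dnxt (c i); rewrite mem_cs // index_cs.
have nxtN x : x \notin cs -> d x = (d (nxt x)).+1.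
  by move=> nx; have [_] := Dnxt x; rewrite (negPf nx).
have enxt x : e x (nxt x) by have [] := Dnxt x.
exists nxt, d; split=> // [i lt_i|]; first by rewrite dC //= mem_cs.
apply: functional_edges => // x.
have [/csP[i lt_i ->]|nx] := boolP (x \in cs).
  rewrite !nxtC ?ltn_pmod //; apply/eqP => /c_inj; rewrite !inE ltn_pmod //.
  rewrite lt_i => /(_ isT isT) /eqP.
  rewrite -addn1 modnDml addn1 -{2}(modn_small lt_i) -addn2 -{2}[i]addn0 eqn_modDl.
  by rewrite !modn_small.
have [/csP[i lt_i Dx]|nx'] := boolP (nxt x \in cs).
  by apply: contraNneq nx => <-; rewrite Dx nxtC // mem_cs // ltn_pmod.
apply/eqP => /(congr1 d) E; have := nxtN _ nx; rewrite (nxtN _ nx') E.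
by move/eqP; rewrite -addn2 -[X in X == _]addn0 eqn_add2l.
Qed.

End Unicycle.

(** * Walks on a line *)

Section LineWalk.

(** Position 0 stands for the deleted root: a walk arriving there is discarded. *)
Definition line_step (a : nat -> nat) (i : nat) : nat :=
  if i is j.+1 then a j + a i.+1 else 0.

Local Open Scope ring_scope.

Lemma line_stepE (R : pzRingType) n (z : nat -> 'rV[R]_n) (K : 'M_n) L (a : nat -> nat) :
  z 0%N = 0 -> a 0%N = 0%N -> (forall i, (L <= i)%N -> a i = 0%N) ->
  (forall i, (0 < i < L)%N -> z i *m K = z i.-1 + z i.+1) ->
  (\sum_(i < L) (a i)%:R *: z i) *m K = \sum_(i < L.+1) (line_step a i)%:R *: z i.
Proof.
move=> z0 a0 aL zK.
case: L aL zK => [|L] aL zK.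
  by rewrite big_ord_recl !big_ord0 mul0mx /= scale0r addr0.
rewrite mulmx_suml big_ord_recl /= a0 scale0r mul0mx add0r.
rewrite big_ord_recl /= scale0r add0r.
transitivity (\sum_(i < L) ((a i.+1)%:R *: z i + (a i.+1)%:R *: z i.+2)).
  by apply: eq_bigr => i _; rewrite -scalemxAl zK ?scalerDr //= /bump /= add1n ltnS.
rewrite big_split /= addrC.
under [RHS]eq_bigr => i _ do rewrite /bump /= add1n natrD scalerDl.
rewrite [RHS]big_split /=; congr (_ + _).
  by rewrite [RHS]big_ord_recl /= a0 scale0r add0r; apply: eq_bigr.
rewrite [RHS]big_ord_recr /= aL // scale0r addr0.
case: L {zK} aL => [|L] aL; first by rewrite !big_ord0.
rewrite big_ord_recl /= z0 scaler0 add0r [RHS]big_ord_recr /=.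
by rewrite aL // scale0r addr0; apply: eq_bigr.
Qed.

(* Number of walks of length m from 1 to i on the positive half-line. *)
Fixpoint half_line (m : nat) : nat -> nat :=
  if m is m'.+1 then line_step (half_line m') else fun i => (i == 1)%N : nat.

Lemma half_line0 m : half_line m 0 = 0%N. Proof. by case: m. Qed.

Lemma half_line_out m i : (m.+1 < i)%N -> half_line m i = 0%N.
Proof.
elim: m i => [|m IH] [|i] //=; first by case: i.
by rewrite ltnS => lt_i; rewrite !IH // ltnW // ltnW.
Qed.

Lemma half_line_top m : half_line m m.+1 = 1%N.
Proof. by elim: m => //= m ->; rewrite half_line_out. Qed.

(** After m steps positions up to m + 1 are occupied, so even for m = L nothing is needed about
    [z L.+1 *m K]: the end of an arm is reached but not left. *)
Lemma half_line_walk (R : pzRingType) n (z : nat -> 'rV[R]_n) (K : 'M_n) L m :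
  z 0%N = 0 -> (forall i, (0 < i <= L)%N -> z i *m K = z i.-1 + z i.+1) ->
  (m <= L)%N -> z 1%N *m K ^+ m = \sum_(i < m.+2) (half_line m i)%:R *: z i.
Proof.
move=> z0 zK; elim: m => [|m IH] lem.
  by rewrite mulmx1 2!big_ord_recl big_ord0 /= scale0r add0r addr0 scale1r.
rewrite exprSr [z 1%N *m _]mulmxA IH ?(ltnW lem) // (@line_stepE _ _ z) ?half_line0 //.
  by move=> i; apply: half_line_out.
by move=> i /andP[i0 lti]; rewrite zK // i0 (leq_trans _ lem).
Qed.

(* Number of walks of length m from s to i on the path 1, ..., k - 1. *)
Fixpoint segment (k s m : nat) (i : nat) : nat :=
  if m is m'.+1 then (i < k) * line_step (segment k s m') i else (i < k) * (i == s).

Lemma segment_out k s m i : (k <= i)%N -> segment k s m i = 0%N.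
Proof. by case: m => [|m] /=; rewrite leqNgt => /negPf->. Qed.

Lemma segment0 k s m : (0 < s)%N -> segment k s m 0 = 0%N.
Proof. by case: m => [|m] /= s0; rewrite ?muln0 // eq_sym gtn_eqF ?muln0. Qed.

Lemma segment_walk (R : pzRingType) n (z : nat -> 'rV[R]_n) (K : 'M_n) k s m :
  z 0%N = 0 -> z k = 0 -> (forall i, (0 < i < k)%N -> z i *m K = z i.-1 + z i.+1) ->
  (0 < s < k)%N -> z s *m K ^+ m = \sum_(i < k) (segment k s m i)%:R *: z i.
Proof.
move=> z0 zk zK /andP[s0 sk]; elim: m => [|m IH].
  rewrite mulmx1 (bigD1 (Ordinal sk)) //= big1 ?addr0; last first.
    by move=> i; rewrite -val_eqE /= => /negPf->; rewrite muln0 scale0r.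
  by rewrite sk eqxx scale1r.
rewrite exprSr [z s *m _]mulmxA IH (@line_stepE _ _ z) ?segment0 //.
  rewrite big_ord_recr /= zk scaler0 addr0; apply: eq_bigr => i _.
  by rewrite ltn_ord mul1n.
by move=> i; apply: segment_out.
Qed.

(** The reflection i -> k - i of the path swaps the two cycle neighbours of the root. *)
Lemma segment_rev k s m i : (0 < s < k)%N -> (0 < i < k)%N ->
  segment k s m i = segment k (k - s) m (k - i).
Proof.
move=> /andP[s0 sk]; have s0' : (0 < k - s)%N by rewrite subn_gt0.
elim: m i => [|m IH] i /andP[i0 ik].
  rewrite /= ik ltn_subrL i0 (ltn_trans i0 ik) /=; congr (_ * nat_of_bool _)%N.
  by lia.
rewrite /= ik ltn_subrL i0 (ltn_trans i0 ik) /=; congr (_ * _)%N.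
case: i i0 ik => [|i] // _ ik /=.
have -> : (k - i.+1)%N = (k - i.+2).+1 by lia.
have E2 : (k - i.+2).+2 = (k - i)%N by lia.
rewrite /= E2 addnC; congr (_ + _)%N.
  have [eik|nik] := eqVneq i.+2 k.
    by rewrite eik subnn segment_out // segment0.
  by rewrite IH //; lia.
case: i ik {E2} => [|i] ik; last by apply: IH; lia.
by rewrite subn0 [RHS]segment_out // segment0.
Qed.

Lemma segment_parity k s m i : odd (s + m + i) -> segment k s m i = 0%N.
Proof.
elim: m i => [|m IH] i.
  by rewrite addn0 /=; case: eqP => [->|_]; rewrite ?muln0 // addnn odd_double.
case: i => [|i] /= od; first by rewrite muln0.
rewrite !IH ?muln0 //; first by rewrite addnS -addSn -addnS.
by move: od; rewrite addnS addnS /= negbK.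
Qed.

Lemma segment_early k m i : (m + i < k.-1)%N -> segment k k.-1 m i = 0%N.
Proof.
elim: m i => [|m IH] i lt; first by rewrite /= ltn_eqF ?muln0.
case: i lt => [|i] lt /=; first by rewrite muln0.
rewrite !IH ?muln0 //; first by rewrite addnS -addSn.
by rewrite (leq_trans _ lt) // addnS addSn ltnS ltnW.
Qed.

(** Only the direct walk has this minimal length. With [segment_early], the first walk from u_(k-1)
    to u_1 has length k - 2 and is unique, which makes the series of the cycle monic. *)
Lemma segment_first k m i : (0 < i)%N -> (m + i = k.-1)%N -> segment k k.-1 m i = 1%N.
Proof.
case: k => [|k]; first by case: i => // i _; rewrite addnS.
rewrite /=; elim: m i => [|m IH] i i0 Ei.
  by rewrite /= -Ei add0n eqxx ltnSn.
case: i i0 Ei => // i _ Ei.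
rewrite /= ltnS -{1}Ei leq_addl mul1n (segment_early (k := k.+1)) ?add0n.
  by rewrite IH // addnS -addSn.
by rewrite /= -Ei addnS addSn ltnS.
Qed.

End LineWalk.

(** * The walk matrix with the root removed *)

Section RootedMatrix.
Local Open Scope ring_scope.
Variables (T : finType) (e : rel T) (u : T) (n : nat) (tau : 'I_(1 + n) -> T).
Hypotheses (esym : symmetric e) (tauB : bijective tau) (tau0 : tau (lshift n ord0) = u).

Let tau' (i : 'I_n) : T := tau (rshift 1 i).

(** Also defined at the removed root, where it is 0, so walks through [u] drop out by themselves. *)
Definition delta (x : T) : 'rV[rat]_n := \row_j (tau' j == x)%:R.

Definition pruned_mx : 'M[rat]_n :=
  \matrix_(i, j) ((e (tau' i) (tau' j))%:R * (2 / (deg e (tau' i))%:R)).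

(** This matrix symmetrises [K] and fixes the indicators of vertices of degree 2. *)
Definition inv_deg_mx : 'M[rat]_n := diag_mx (\row_i (2 / (deg e (tau' i))%:R)).

Local Notation K := pruned_mx.
Local Notation W := inv_deg_mx.

Lemma tau'_neq i : tau' i != u.
Proof.
by rewrite -tau0 /tau' (inj_eq (bij_inj tauB)) -val_eqE.
Qed.

Lemma tau'_inj : injective tau'.
Proof. by move=> i j /(bij_inj tauB) /rshift_inj. Qed.

Lemma tau'_surj x : x != u -> exists i, tau' i = x.
Proof.
case: tauB => s sK Ks xu; have := splitP (s x) => -[j Ej|j Ej].
  case/eqP: xu; rewrite -(Ks x) -tau0; congr tau; apply: val_inj.
  by rewrite /= Ej ord1.
by exists j; rewrite -(Ks x) /tau'; congr tau; apply: val_inj.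
Qed.

Lemma delta_root : delta u = 0.
Proof. by apply/rowP=> j; rewrite !mxE (negPf (tau'_neq j)). Qed.

Lemma sum_delta (F : 'I_n -> rat) (i : 'I_n) :
  \sum_j (tau' j == tau' i)%:R * F j = F i.
Proof.
rewrite (bigD1 i) //= eqxx mul1r big1 ?addr0 // => j /negPf nj.
by rewrite (inj_eq tau'_inj) nj mul0r.
Qed.

Lemma delta_dot x y : x != u -> delta x *m (delta y)^T = ((x == y)%:R)%:M.
Proof.
move=> /tau'_surj[i <-]; rewrite [LHS]mx11_scalar; congr (_ %:M).
rewrite mxE -[RHS](sum_delta (fun j => (tau' j == y)%:R)).
by apply: eq_bigr => j _; rewrite !mxE.
Qed.

Lemma delta_mul x : x != u ->
  delta x *m K = (2 / (deg e x)%:R) *: \sum_(y | e x y) delta y.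
Proof.
move=> /tau'_surj[i <-]; apply/rowP=> j; rewrite !mxE summxE.
under eq_bigr do rewrite !mxE.
rewrite sum_delta mulrC; congr (_ * _).
have [eij|neij] := boolP (e _ _).
  rewrite (bigD1 (tau' j)) //= mxE eqxx big1 ?addr0 // => y /andP[_ ny].
  by rewrite mxE eq_sym (negPf ny).
rewrite big1 // => y ey; rewrite mxE; case: eqP => // E.
by rewrite E ey in neij.
Qed.

Lemma sum_pred2 x a b : e x =1 pred2 a b -> a != b ->
  \sum_(y | e x y) delta y = delta a + delta b.
Proof.
move=> exE ab; rewrite (eq_bigl _ _ exE) (bigD1 a) /= ?eqxx //; congr (_ + _).
apply: big_pred1 => y /=.
by case: (eqVneq y a) => [->|_] /=; rewrite ?andbT // ?(negPf ab).
Qed.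

Lemma delta_mul_deg2 x a b : x != u -> deg e x = 2%N -> e x a -> e x b -> a != b ->
  delta x *m K = delta a + delta b.
Proof.
move=> xu dx ea eb ab; rewrite delta_mul // dx divff ?scale1r //.
exact: sum_pred2 (deg2_adjE dx ea eb ab) ab.
Qed.

Lemma delta_inv_deg x : delta x *m W = (2 / (deg e x)%:R) *: delta x.
Proof.
apply/rowP=> j; rewrite mul_mx_diag !mxE mulrC.
by case: eqP => [->|_]; rewrite ?mulr0.
Qed.

(** With A the adjacency matrix off the root, [K = W A], so [K W = W A W] is symmetric: the random
    walk is reversible. *)
Lemma reversible m : K ^+ m *m W = W *m (K ^+ m)^T.
Proof.
elim: m => [|m IH]; first by rewrite mul1mx trmx1 mulmx1.
have KW : K *m W = W *m K^T.
  apply/matrixP=> i j; rewrite mul_mx_diag mul_diag_mx !mxE (esym (tau' j)).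
  by rewrite mulrAC mulrA [RHS]mulrC [_ * (2 / _)]mulrC -!mulrA [_%:R * _]mulrC.
rewrite exprS -mulmxA IH mulmxA KW -mulmxA; congr (_ *m _).
by rewrite -trmx_mul -[K ^+ m *m K]exprSr exprS.
Qed.

Lemma reversible_form m (x y : 'rV[rat]_n) :
  x *m K ^+ m *m W *m y^T = y *m K ^+ m *m W *m x^T.
Proof.
have tr11 (A : 'M[rat]_1) : A^T = A by rewrite [A]mx11_scalar tr_scalar_mx.
by rewrite -[LHS]tr11 !trmx_mul trmxK tr_diag_mx !mulmxA -[y *m W *m _]mulmxA -reversible !mulmxA.
Qed.

Hypotheses (du : deg e u = 4%N) (deg_nbr : forall y, e u y -> deg e y = 2%N).

Definition nbrs_row : 'rV[rat]_n := \sum_(y | e u y) delta y.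

(** The factor 1/2 in the row is 2 / deg u; the column has entries 0 and 1 because the neighbours of
    [u] have degree 2. *)
Lemma walk_mx_block : irreflexive e ->
  walk_mx e tau = block_mx 0 (2^-1 *: nbrs_row) nbrs_row^T K.
Proof.
move=> eirr; apply/matrixP=> i j; rewrite -[i]splitK -[j]splitK.
have nbrsE (l : 'I_n) : nbrs_row 0 l = (e u (tau' l))%:R.
  rewrite summxE; have [el|nel] := boolP (e u (tau' l)).
    rewrite (bigD1 (tau' l)) //= mxE eqxx big1 ?addr0 // => y /andP[_ ny].
    by rewrite mxE eq_sym (negPf ny).
  rewrite big1 // => y ey; rewrite mxE; case: eqP => // E.
  by rewrite E ey in nel.
case: (split i) => i'; case: (split j) => j' /=.
- by rewrite block_mxEul !mxE !ord1 tau0 eirr mul0r.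
- rewrite block_mxEur !mxE !ord1 tau0 nbrsE -/(tau' j') mulrC du.
  by congr (_ * _).
- rewrite block_mxEdl [RHS]mxE !ord1 nbrsE !mxE tau0 -/(tau' i') (esym _ u).
  by case: (boolP (e u _)) => [/deg_nbr->|_]; rewrite ?mul0r // mul1r divff.
by rewrite block_mxEdr !mxE.
Qed.

(** An odd power of [K] anticommutes with the sign matrix [S] of the colouring, while [x] is an
    eigenvector of [S], so the form equals its own negative. *)
Lemma parity_form (f : T -> bool) s m (x : 'rV[rat]_n) :
  (forall y z, y != u -> z != u -> e y z -> f y != f z) ->
  x *m diag_mx (\row_i (-1) ^+ f (tau' i)) = (-1) ^+ s *: x -> odd m ->
  x *m K ^+ m *m x^T = 0.
Proof.
move=> fe; set S := diag_mx _ => xS oddm.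
have SS : S *m S = 1%:M := sign_mx_sqr _ _.
have KS : K *m S = - (S *m K).
  rewrite -[K *m S]mul1mx -SS -mulmxA -mulmxN; congr (_ *m _).
  rewrite mulmxA; apply: sign_conj_mx => i j; rewrite !mxE => nz.
  apply: fe; rewrite ?tau'_neq //.
  by apply: contraNT nz => /negPf->; rewrite mul0r.
have KmS : K ^+ m *m S = - (S *m K ^+ m).
  rewrite -[m]odd_double_half oddm -mul2n exprD exprM expr1.
  have K2S : K ^+ 2 *m S = S *m K ^+ 2.
    by rewrite expr2 -mulmxA KS mulmxN mulmxA KS mulNmx opprK mulmxA.
  have K2mS l : (K ^+ 2) ^+ l *m S = S *m (K ^+ 2) ^+ l.
    elim: l => [|l IH]; first by rewrite mul1mx mulmx1.
    by rewrite [(K ^+ 2) ^+ l.+1]exprS -mulmxA IH mulmxA K2S -mulmxA.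
  by rewrite -mulmxA K2mS mulmxA KS mulNmx mulmxA.
have SxT : S *m x^T = (-1) ^+ s *: x^T.
  by rewrite -[S]tr_diag_mx -trmx_mul xS linearZ.
have E : x *m K ^+ m *m x^T = - (x *m K ^+ m *m x^T).
  apply: (can_inj (signrZK s)); rewrite scalemxAr -SxT mulmxA -[_ *m S]mulmxA KmS.
  by rewrite mulmxN mulmxA xS !mulNmx -!scalemxAl scalerN.
have : x *m K ^+ m *m x^T + x *m K ^+ m *m x^T = 0 by rewrite {1}E addNr.
by rewrite -mulr2n -scaler_nat => /eqP; rewrite scaler_eq0 /= => /eqP.
Qed.

End RootedMatrix.

(** * Paths leaving the cycle at the root *)

Section Arms.
Variables (T : finType) (e : rel T) (C : pred T) (nxt : T -> T) (u : T).
Hypothesis nxtP : forall x y, e x y -> (y == nxt x) || (x == nxt y).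
Hypothesis nxtC : forall x, C x -> C (nxt x).
Hypothesis Cu : C u.

Definition arm (t : nat) (a : nat -> T) :=
  [/\ a 0 = u, e u (a 1), ~~ C (a 1) &
      forall j, 2 <= j <= t.+1 -> e (a j.-1) (a j) /\ a j != a j.-2].

(** [nxt] never leaves [C], so the first edge points back to [u]. Each later edge does too, since
    [nxt (a j)] is already [a j.-1], which differs from [a j.+1]. *)
Lemma arm_nxt t a : arm t a -> forall j, j <= t -> ~~ C (a j.+1) /\ nxt (a j.+1) = a j.
Proof.
case=> a0 e1 nC1 aP; elim=> [|j IH] lej.
  split=> //; rewrite a0; have /orP[/eqP E|/eqP<-//] := nxtP e1.
  by rewrite E nxtC in nC1.
have [nC Ej] := IH (ltnW lej).
have /= [ej nj] := aP j.+2 lej.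
have /orP[/eqP E|/eqP E] := nxtP ej; first by rewrite E Ej eqxx in nj.
split; last by rewrite -E.
by apply: contra nC => Cj; rewrite E nxtC.
Qed.

Lemma arm_edge t a j : arm t a -> j <= t -> e (a j) (a j.+1).
Proof.
by case=> a0 e1 _ aP; case: j => [|j] lej; [rewrite a0 | have [] := aP j.+2 lej].
Qed.

(** Applying [nxt] to both sides descends along both arms at once until [u], the only arm vertex in
    [C], is met. For equal arms this is injectivity; for distinct first vertices it is disjointness
    outside [u]. *)
Lemma arms_eq t a b i j : arm t a -> arm t b -> i <= t.+1 -> j <= t.+1 ->
  a i = b j -> i = j /\ (0 < i -> a 1 = b 1).
Proof.
move=> aA bA; elim: i j => [|i IH] [|j] // lei lej E.
- have [nC _] := arm_nxt bA lej; case: aA => a0 _ _ _.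
  by rewrite -E a0 Cu in nC.
- have [nC _] := arm_nxt aA lei; case: bA => b0 _ _ _.
  by rewrite E b0 Cu in nC.
have [_ Ea] := arm_nxt aA lei; have [_ Eb] := arm_nxt bA lej.
have [Eij E1] : i = j /\ (0 < i -> a 1 = b 1).
  by apply: IH; rewrite ?(ltnW lei) ?(ltnW lej) // -Ea -Eb E.
by rewrite Eij; split=> // _; case: i {IH lei Ea} Eij E1 E => [<- _ //|i _ E1 _]; apply: E1.
Qed.

End Arms.

(** Clearing denominators gives z a b = a + b, so a and b divide each other; then a = b and z b =
    2. *)
Lemma inv_nat_sum_int (a b : nat) : 0 < a -> 0 < b ->
  ((a%:R^-1 + b%:R^-1)%R : rat) \is a Num.int -> (a = 1 /\ b = 1) \/ (a = 2 /\ b = 2).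
Proof.
move=> a0 b0 /intrP[z Ez].
have nz (m : nat) : 0 < m -> (m%:R : rat)%R != 0%R by rewrite pnatr_eq0 lt0n.
have {Ez} : ((b + a)%N%:Z = z * (a * b)%N%:Z)%R.
  apply/(@intr_inj rat); rewrite rmorphM /= -Ez -!pmulrn natrM natrD mulrDl.
  by rewrite mulrA mulVf ?nz // mul1r [(a%:R * _)%R]mulrC mulrA mulVf ?nz // mul1r.
case: z => z Ez; last by nia.
have {Ez} Ez : b + a = z * (a * b) by lia.
have leba : b <= a.
  by apply: dvdn_leq => //; rewrite -(dvdn_addr _ (dvdnn b)) Ez mulnA dvdn_mull.
have leab : a <= b.
  by apply: dvdn_leq => //; rewrite -(dvdn_addl _ (dvdnn a)) Ez mulnCA dvdn_mulr.
have Eab : a = b by apply/eqP; rewrite eqn_leq leab.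
have za : z * b = 2 by apply/eqP; rewrite -(eqn_pmul2r b0) -mulnA -{1}Eab -Ez Eab mul2n addnn.
have leb2 : b <= 2 by apply: dvdn_leq => //; rewrite -za dvdn_mull.
lia.
Qed.

(** * Walks along the cycle and along the two arms *)

Section UnicycleArms.
Local Open Scope ring_scope.
Variables (T : finType) (e : rel T) (k : nat) (c v w : nat -> T) (t : nat).
Variables (nxt : T -> T) (d : T -> nat) (n : nat) (tau : 'I_(1 + n) -> T).
Local Notation u := (c 0%N).
Let cs := mkseq c k.

Hypotheses (k3 : (3 <= k)%N) (oddk : odd k) (esym : symmetric e) (eirr : irreflexive e).
Hypothesis c_inj : {in [pred i | (i < k)%N] &, injective c}.
Hypothesis c_edge : forall i, (i < k)%N -> e (c i) (c (i.+1 %% k)%N).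
Hypotheses (du : deg e u = 4%N) (dc : forall i, (1 <= i < k)%N -> deg e (c i) = 2%N).
Hypotheses (nxt_c : forall i, (i < k)%N -> nxt (c i) = c (i.+1 %% k)%N)
  (d_c : forall i, (i < k)%N -> d (c i) = 0%N)
  (d_nxt : forall x, x \notin cs -> d x = (d (nxt x)).+1)
  (nxtP : forall x y, e x y -> (y == nxt x) || (x == nxt y)).
Hypotheses (vA : arm e (mem cs) u t v) (wA : arm e (mem cs) u t w) (vw : v 1%N != w 1%N).
Hypothesis t0 : (0 < t)%N.
Hypothesis d_arm : forall j, (1 <= j <= t)%N -> deg e (v j) = 2%N /\ deg e (w j) = 2%N.
Hypotheses (tauB : bijective tau) (tau0 : tau (lshift n ord0) = u).

Local Notation K := (pruned_mx e tau).
Local Notation W := (inv_deg_mx e tau).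
Local Notation delta := (delta tau).

Let k0 : (0 < k)%N. Proof. by apply: leq_trans k3. Qed.
Let ucs : u \in cs. Proof. exact: mem_cs. Qed.

Lemma nxt_cs x : x \in cs -> nxt x \in cs.
Proof. by case/csP=> i lt_i ->; rewrite nxt_c // mem_cs // ltn_pmod. Qed.

Lemma c_neq i j : (i < k)%N -> (j < k)%N -> (c i == c j) = (i == j).
Proof. by move=> lti ltj; apply/eqP/eqP => [/c_inj->|->]; rewrite ?inE. Qed.

Lemma c_prev i : (0 < i < k)%N -> e (c i) (c i.-1).
Proof.
case: i => // i /= lti; rewrite esym; have := c_edge (ltnW lti).
by rewrite modn_small.
Qed.

Lemma c_prev_next_neq i : (0 < i < k)%N -> c i.-1 != c (i.+1 %% k)%N.
Proof.
case: i => // i /= lti; rewrite c_neq ?ltn_pmod ?(ltnW lti) //.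
have [lt|gt|E] := ltngtP i.+2 k; first by rewrite modn_small //; lia.
  by lia.
by rewrite E modnn; lia.
Qed.

Lemma c_adj i : (0 < i < k)%N -> e (c i) =1 pred2 (c i.-1) (c (i.+1 %% k)%N).
Proof.
move=> ik; case/andP: (ik) => _ ltk.
by apply: deg2_adjE; rewrite ?dc ?c_prev ?c_edge ?c_prev_next_neq.
Qed.

(** A 2-colouring of the forest left when [u] is removed. The odd cycle opens into a path coloured
    by position; other vertices are coloured by [d], their number of [nxt] steps to the cycle, and
    touch the cycle only at [u]. *)
Definition colour x := if x \in cs then odd (index x cs) else odd (d x).

Lemma colour_edge x y : x != u -> y != u -> e x y -> colour x != colour y.
Proof.
wlog Dy : x y / y = nxt x => [wl xu yu exy|].
  case/orP: (nxtP exy) => /eqP E; first exact: wl.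
  by rewrite eq_sym; apply: wl; rewrite // esym.
move=> xu yu exy; rewrite /colour.
have [/(csP k c)[i lti Dx]|nx] := boolP (x \in cs).
  have Di : y = c (i.+1 %% k)%N by rewrite Dy Dx nxt_c.
  have ltik : (i.+1 < k)%N.
    by rewrite ltn_neqAle lti andbT; apply: contraNneq yu => Ei; rewrite Di Ei modnn.
  rewrite Di Dx mem_cs ?ltn_pmod // modn_small // !index_cs //=.
  by case: (odd i).
have [/(csP k c)[i lti Ey]|ny] := boolP (y \in cs).
  have i0 : (0 < i < k)%N by rewrite lti andbT lt0n; apply: contraNneq yu => i0; rewrite Ey i0.
  have : e (c i) x by rewrite -Ey esym.
  rewrite c_adj // => /orP[] /eqP Ex; case/negP: nx; rewrite Ex mem_cs ?ltn_pmod //.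
  by apply: leq_ltn_trans lti; apply: leq_pred.
by rewrite (d_nxt nx) -Dy /=; case: (odd _).
Qed.

Let arm_out a j : arm e (mem cs) u t a -> (0 < j <= t.+1)%N -> a j \notin cs.
Proof. by case: j => // j aA lej; case: (arm_nxt nxtP nxt_cs ucs aA lej). Qed.

Let arm_neq_u a j : arm e (mem cs) u t a -> (0 < j <= t.+1)%N -> a j != u.
Proof. by move=> aA lej; apply: contraNneq (arm_out aA lej) => ->. Qed.

Let arms_neq i j : (0 < i <= t.+1)%N -> (j <= t.+1)%N -> v i != w j.
Proof.
move=> /andP[i0 lei] lej; apply: contraNneq vw => E.
by have [_ ->] := arms_eq nxtP nxt_cs ucs vA wA lei lej E.
Qed.

Let arm_inj a i j : arm e (mem cs) u t a -> (i <= t.+1)%N -> (j <= t.+1)%N ->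
  (a i == a j) = (i == j).
Proof.
move=> aA lei lej; apply/eqP/eqP => [E|-> //].
by have [] := arms_eq nxtP nxt_cs ucs aA aA lei lej E.
Qed.

Lemma colour_arms : colour (v 1%N) = colour (w 1%N).
Proof.
have d1 a : arm e (mem cs) u t a -> colour (a 1%N) = true.
  move=> aA; have [nC E] := arm_nxt nxtP nxt_cs ucs aA (leq0n t).
  rewrite /colour (negPf nC) d_nxt // E.
  by case: aA => -> _ _ _; rewrite d_c.
by rewrite !d1.
Qed.

Let dot x y : y != u -> delta x *m (delta y)^T = ((x == y)%:R)%:M.
Proof.
move=> yu; have [->|xu] := eqVneq x u; last by rewrite (delta_dot tauB tau0).
rewrite delta_root // mul0mx [u == y]eq_sym (negPf yu).
by apply/matrixP=> i j; rewrite !mxE mul0rn.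
Qed.

(* The value 0 at k reflects that c k would be the removed vertex u. *)
Let zc i := if (i < k)%N then delta (c i) else 0.
Let zc0 : zc 0 = 0. Proof. by rewrite /zc k0 delta_root. Qed.
Let zck : zc k = 0. Proof. by rewrite /zc ltnn. Qed.

Let zcK i : (0 < i < k)%N -> zc i *m K = zc i.-1 + zc i.+1.
Proof.
move=> ik; case/andP: (ik) => i0 lti; rewrite /zc lti (leq_ltn_trans (leq_pred i)) //.
rewrite (@delta_mul_deg2 _ _ u _ _ _ _ _ (c i.-1) (c (i.+1 %% k)%N)) ?c_prev ?c_edge ?dc
  ?c_prev_next_neq //.
  congr (_ + _); case: ltnP => [lt|ge]; first by rewrite modn_small.
  by rewrite (_ : i.+1 = k) ?modnn ?delta_root //; lia.
by rewrite c_neq //; lia.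
Qed.

(** Adding the two arms level by level folds them into one half-line whose position 0 is the deleted
    root. *)
Let za i : 'rV[rat]_n := delta (v i) + delta (w i).
Let za0 : za 0 = 0.
Proof. by case: vA wA => v0 _ _ _ [w0 _ _ _]; rewrite /za v0 w0 delta_root ?addr0. Qed.

Let armK a j : arm e (mem cs) u t a -> (forall j, (1 <= j <= t)%N -> deg e (a j) = 2%N) ->
  (0 < j <= t)%N -> delta (a j) *m K = delta (a j.-1) + delta (a j.+1).
Proof.
move=> aA da jt; case/andP: (jt) => j0 let_.
apply: (@delta_mul_deg2 _ _ u) => //.
- by rewrite arm_neq_u // j0 ltnW.
- exact: da.
- by rewrite esym -{2}(prednK j0) (arm_edge aA) // (leq_trans (leq_pred j)).
- exact: arm_edge aA _.
by rewrite arm_inj //; lia.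
Qed.

Let zaK i : (0 < i <= t)%N -> za i *m K = za i.-1 + za i.+1.
Proof.
move=> it; rewrite mulmxDl !armK //; first exact: addrACA.
  by move=> j /d_arm[].
by move=> j /d_arm[].
Qed.

(** The neighbours of [u] split into those on the cycle, now a path, and those starting the arms, a
    half-line. *)
Let rP := zc 1 + zc k.-1.
Let rH := za 1.

Let s4 := [:: c 1; c k.-1; v 1; w 1].
Let s4_uniq : uniq s4.
Proof.
have vout := arm_out vA (isT : (0 < 1 <= t.+1)%N).
have wout := arm_out wA (isT : (0 < 1 <= t.+1)%N).
have neq a i : a \notin cs -> (i < k)%N -> c i != a.
  by move=> na lti; apply: contraNneq na => <-; apply: mem_cs.
have k1 : (k.-1 < k)%N by lia.
have k2 : (1 < k)%N by lia.
have c1k : c 1%N != c k.-1 by rewrite c_neq //; lia.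
by rewrite /= !inE !negb_or c1k vw !(neq _ _ vout) ?(neq _ _ wout).
Qed.

Let nbrsE y : e u y = (y \in s4).
Proof.
have sub : {subset s4 <= e u}.
  move=> x; rewrite !inE => /or4P[] /eqP->; first 1 last.
  - rewrite unfold_in esym; have := @c_edge k.-1; rewrite prednK // modnn; apply.
    by lia.
  - by case: vA.
  - by case: wA.
  by rewrite unfold_in; have := c_edge k0; rewrite modn_small // ltnW.
have card4 : #|s4| = #|e u|.
  by rewrite (card_uniqP s4_uniq) [LHS]/= -du; apply: eq_card.
have sub4 : s4 \subset e u by apply/subsetP.
by have /(_ y) := subset_cardP card4 sub4; rewrite [RHS]unfold_in => ->.
Qed.

Let deg_nbr y : e u y -> deg e y = 2%N.
Proof.
have t1 : (0 < 1 <= t)%N by [].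
rewrite nbrsE !inE => /or4P[] /eqP->; rewrite ?dc //; try lia.
  by case: (d_arm t1).
by case: (d_arm t1).
Qed.

Let nbrs_rowE : nbrs_row e u tau = rP + rH.
Proof.
rewrite /nbrs_row (eq_bigl _ _ nbrsE) -big_uniq //= !big_cons big_nil addr0.
have k1 : (k.-1 < k)%N by lia.
have k2 : (1 < k)%N by lia.
by rewrite /rP /rH /za /zc k1 k2 !addrA.
Qed.

Let form (x : 'rV[rat]_n) m (y : 'rV[rat]_n) : rat := (x *m K ^+ m *m y^T) 0 0.

Let zc_form s m j : (0 < s < k)%N -> (0 < j < k)%N ->
  form (zc s) m (zc j) = (segment k s m j)%:R.
Proof.
move=> sk /andP[j0 jk]; rewrite /form (segment_walk m zc0 zck zcK sk) mulmx_suml summxE.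
rewrite (bigD1 (Ordinal jk)) //= /zc jk -scalemxAl dot ?eqxx; last first.
  by rewrite c_neq // -lt0n.
rewrite !mxE eqxx mulr1 big1 ?addr0 // => i; rewrite -val_eqE /= => ni.
rewrite ltn_ord -scalemxAl dot ?c_neq -?lt0n // (negPf ni) !mxE.
by rewrite mul0rn mulr0.
Qed.

Let zc_za_form s m : (0 < s < k)%N -> form (zc s) m rH = 0.
Proof.
move=> sk; rewrite /form (segment_walk m zc0 zck zcK sk) mulmx_suml summxE big1 // => i _.
rewrite /zc ltn_ord -scalemxAl /rH /za linearD mulmxDr /=.
have one : (0 < 1 <= t.+1)%N by [].
rewrite !dot ?arm_neq_u // !mxE.
have neq a : arm e (mem cs) u t a -> (c i == a 1%N) = false.
  by move=> aA; apply/negbTE; apply: contraNneq (arm_out aA one) => <-; apply: mem_cs.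
by rewrite !neq // !mul0rn addr0 mulr0.
Qed.

Let formDl x x' m y : form (x + x') m y = form x m y + form x' m y.
Proof. by rewrite /form !mulmxDl mxE. Qed.

Let formDr x m y y' : form x m (y + y') = form x m y + form x m y'.
Proof. by rewrite /form linearD mulmxDr mxE. Qed.

Let form_sym x m y : x *m W = x -> y *m W = y -> form x m y = form y m x.
Proof.
move=> xW yW; have Wtr (z : 'rV[rat]_n) : z *m W = z -> W *m z^T = z^T.
  by move=> zW; rewrite -[in RHS]zW trmx_mul tr_diag_mx.
by rewrite /form -(Wtr y yW) mulmxA reversible_form // -mulmxA (Wtr x xW).
Qed.

Let delta_W x : deg e x = 2%N -> delta x *m W = delta x.
Proof. by move=> dx; rewrite delta_inv_deg dx divff ?scale1r. Qed.

Let rP_W : rP *m W = rP.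
Proof.
have k1 : (k.-1 < k)%N by lia.
have k2 : (1 < k)%N by lia.
have d1 : deg e (c 1%N) = 2%N by apply: dc; lia.
have d2 : deg e (c k.-1) = 2%N by apply: dc; lia.
by rewrite /rP /zc k1 k2 mulmxDl !delta_W.
Qed.

Let rH_W : rH *m W = rH.
Proof.
have [dv dw] := d_arm (t0 : (0 < 1 <= t)%N).
by rewrite mulmxDl !delta_W.
Qed.

Let nu m := 2^-1 * form (rP + rH) m (rP + rH).

(** Mixed terms vanish, as a walk from the cycle avoiding [u] stays on the cycle. Reflection makes
    the four cycle terms equal in pairs, which absorbs the factor 1/2. *)
Let nuE m : nu m = (segment k 1 m 1 + segment k k.-1 m 1)%:R + 2^-1 * form rH m rH.
Proof.
have k1 : (0 < k.-1 < k)%N by lia.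
have k2 : (0 < 1 < k)%N by lia.
have PH : form rP m rH = 0 by rewrite (formDl (zc 1) (zc k.-1)) !zc_za_form // addr0.
rewrite /nu (formDl rP rH) !(formDr _ _ rP rH) PH (form_sym _ rH_W rP_W) PH.
rewrite addr0 add0r mulrDr; congr (_ + _).
have kk : (k - k.-1)%N = 1%N by lia.
have E1 : segment k 1 m k.-1 = segment k k.-1 m 1.
  by rewrite (segment_rev m k2 k1) kk subn1.
have E2 : segment k k.-1 m k.-1 = segment k 1 m 1.
  by rewrite (segment_rev m k1 k1) kk.
rewrite (formDl (zc 1) (zc k.-1)) !(formDr _ _ (zc 1) (zc k.-1)) !zc_form // E1 E2.
by rewrite natrD; field.
Qed.

(** v_1 and w_1 have the same colour, so no walk of odd length avoiding [u] joins them or returns to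
    either. *)
Let formH_odd m : odd m -> form rH m rH = 0.
Proof.
move=> oddm; rewrite /form (parity_form tauB tau0 (s := colour (v 1%N)) colour_edge) ?mxE //.
have dS x : delta x *m diag_mx (\row_i (-1) ^+ colour (tau (rshift 1 i))) =
            (-1) ^+ colour x *: delta x.
  apply/rowP=> j; rewrite mul_mx_diag !mxE mulrC.
  by case: eqP => [->|_]; rewrite ?mulr0.
by rewrite mulmxDl !dS -colour_arms scalerDr.
Qed.

Let za_dot i j : (i <= t.+1)%N -> (0 < j <= t.+1)%N ->
  za i *m W *m (za j)^T =
  ((i == j)%:R * (2 / (deg e (v i))%:R + 2 / (deg e (w i))%:R))%:M.
Proof.
move=> lei lej; have [j0 lej'] := andP lej.
rewrite /za mulmxDl !delta_inv_deg linearD /= mulmxDl !mulmxDr -!scalemxAl.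
rewrite !dot ?arm_neq_u // !arm_inj //.
have -> : (v i == w j) = false.
  case: i lei => [|i] lei; last by apply/negbTE/arms_neq.
  by case: vA => -> _ _ _; rewrite eq_sym; apply/negbTE/arm_neq_u.
have -> : (w i == v j) = false by rewrite eq_sym; apply/negbTE/arms_neq.
apply/matrixP=> a b; rewrite !ord1 !mxE eqxx !mulr1n /=; ring.
Qed.

(** Reversibility cuts a walk of length 2t into two halves of length t meeting at level i, with
    weight 2/deg. Levels up to t give integers; level t + 1 is reached by the straight walk only and
    brings in the unknown degrees. *)
Let formH_even : form rH t.*2 rH =
  (\sum_(1 <= i < t.+1) 2 * half_line t i ^ 2)%:R +
  2 * ((deg e (v t.+1))%:R^-1 + (deg e (w t.+1))%:R^-1).
Proof.
have walk := half_line_walk za0 zaK (leqnn t).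
have -> : form rH t.*2 rH = (rH *m K ^+ t *m W *m (rH *m K ^+ t)^T) 0 0.
  rewrite /form -addnn exprD trmx_mul -!mulmxA; congr (fun_of_matrix (rH *m (_ *m _)) _ _).
  rewrite [RHS]mulmxA -reversible // -mulmxA; congr (_ *m _).
  by rewrite -[in LHS]rH_W trmx_mul tr_diag_mx.
rewrite walk !mulmx_suml summxE.
transitivity (\sum_(i < t.+2) (half_line t i)%:R ^+ 2 *
   (2 / (deg e (v i))%:R + 2 / (deg e (w i))%:R) : rat).
  apply: eq_bigr => i _; rewrite linear_sum mulmx_sumr summxE (bigD1 i) //=.
  rewrite big1 ?addr0 => [|j ne].
    rewrite linearZ /= -!scalemxAl -scalemxAr.
    have [->|i0] := posnP i; first by rewrite half_line0 !scale0r mxE expr2 !mul0r.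
    have lei : (0 < i <= t.+1)%N by rewrite i0 -ltnS ltn_ord.
    rewrite za_dot //; last by case/andP: lei.
    by rewrite eqxx mul1r !mxE eqxx mulr1n expr2 mulrA.
  rewrite linearZ /= -!scalemxAl -scalemxAr.
  have [->|j0] := posnP j; first by rewrite half_line0 scale0r scaler0 mxE.
  have lej : (0 < j <= t.+1)%N by rewrite j0 -ltnS ltn_ord.
  have lei : (i <= t.+1)%N by rewrite -ltnS ltn_ord.
  have /negPf nij : (i : nat) != j by rewrite eq_sym.
  by rewrite za_dot // nij mul0r !mxE mul0rn !mulr0.
rewrite big_ord_recr big_ord_recl /= half_line0 half_line_top expr2 !mul0r add0r expr1n mul1r.
rewrite -!mulrDr natr_sum big_add1 big_mkord /=; congr (_ + _).
apply: eq_bigr => i _; rewrite /bump /= add1n.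
have [dv dw] := d_arm (ltn_ord i : (0 < i.+1 <= t)%N).
by rewrite dv dw divff // natrM natrX mulrC.
Qed.

Hypothesis size_V : (k + t.*2 < n)%N.

Lemma arms_end_int : char_poly (walk_mx e tau) \is a polyOver Num.int ->
  ((deg e (v t.+1))%:R^-1 + (deg e (w t.+1))%:R^-1 : rat) \is a Num.int.
Proof.
rewrite (walk_mx_block esym tau0 du deg_nbr eirr) => /polyOverP.
set g := char_poly _ => gint; pose kappa := char_poly K.
have nu_odd m : odd m -> nu m = (segment k 1 m 1 + segment k k.-1 m 1)%:R.
  by move=> oddm; rewrite nuE formH_odd // mulr0 addr0.
(* By [nuE] and [formH_even], this number differs from the target by an integer. *)
suff: nu t.*2 \is a Num.int.
  rewrite nuE formH_even -big_distrr /= natrM -mulrDr mulKf // (rpredDl _ (natr_int _ _)).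
  by rewrite (rpredDl _ (natr_int _ _)).
(* Coefficients are read from the top degree, as series in 1/x, and are 0 past the constant term. *)
pose Kc l := if (l <= n)%N then kappa`_(n - l) else 0.
pose G l := if (l <= n.+1)%N then g`_(n.+1 - l) else 0.
apply: (@even_coef_int Kc G nu k t) => //.
- by move=> l; rewrite /G; case: ifP => _; [apply: gint | apply: rpred0].
- rewrite /Kc leq0n subn0; have /monicP := char_poly_monic K.
  by rewrite /lead_coef size_char_poly.
- move=> l oddl; rewrite /Kc; case: leqP => // len.
  apply: (@char_poly_bipartite _ _ (fun i => colour (tau (rshift 1 i)))) => // i j.
  rewrite mxE => nz; apply: colour_edge; rewrite ?(tau'_neq tauB tau0) //.
  by apply: contraNT nz => /negPf->; rewrite mul0r.
- move=> m lem; have ltmn : (m < n)%N by apply: leq_ltn_trans lem size_V.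
  rewrite /G ltnS ltmn subSS /g char_poly_bordered coefB coefXM.
  rewrite (@coef_mul_adj_char_poly _ _ _ _ _ _ m.+1); last by lia.
  congr (_ - _).
    (* At the boundary m + 1 = n both sides are 0: the constant coefficient of ['X * kappa] and the
       default value of [Kc]. *)
    rewrite /Kc -/kappa; case: leqP => lt2; first by rewrite ifT //; lia.
    by rewrite [in RHS]subnS ifF //; lia.
  apply: eq_bigr => i _; rewrite /Kc ifT; last by lia.
  have lti := ltn_ord i.
  have -> : ((n - m.+1).+1 + i)%N = (n - (m - i))%N by lia.
  congr (_ * _).
  by rewrite /nu /form -nbrs_rowE -!scalemxAl mxE.
- by move=> m oddm; rewrite nu_odd // natr_int.
- move=> m oddm ltm; rewrite nu_odd // segment_parity ?segment_early //; first by lia.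
  by rewrite add1n addn1 /= negbK.
- have odd2 : odd (k - 2) by rewrite oddB ?oddk // ltnW.
  rewrite nu_odd // segment_parity; last by rewrite add1n addn1 /= negbK.
  by rewrite segment_first //; lia.
- by rewrite odd_double.
Qed.

End UnicycleArms.

(** * The dichotomy for the ends of the two arms *)

Theorem theorem3p8 (T : finType) (e : rel T) (k : nat)
    (c : nat -> T) (v w : nat -> T) (t p : nat) :
  (3 <= k)%N -> odd k ->
  odd_unicycle e ->
  (* the Grover walk is periodic with odd period p *)
  grover_period e p -> odd p ->
  (* the (unique) cycle u = c 0, u_1 = c 1, ..., u_{k-1} = c (k-1), of length k *)
  {in [pred i | (i < k)%N] &, injective c} ->
  (forall i : nat, (i < k)%N -> e (c i) (c ((i.+1) %% k)%N)) ->
  deg e (c 0%N) = 4%N ->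
  (forall i : nat, (1 <= i < k)%N -> deg e (c i) = 2%N) ->
  (* v_0 = w_0 = u; v_1, w_1 the two neighbours of u off the cycle *)
  v 0%N = c 0%N -> w 0%N = c 0%N ->
  e (c 0%N) (v 1%N) -> e (c 0%N) (w 1%N) -> v 1%N != w 1%N ->
  (forall i : nat, (i < k)%N -> v 1%N != c i /\ w 1%N != c i) ->
  (1 <= t)%N ->
  (* v_j (resp. w_j) is the neighbour of v_{j-1} other than v_{j-2}, 2 <= j <= t+1 *)
  (forall j : nat, (2 <= j <= t.+1)%N ->
      e (v j.-1) (v j) /\ v j != v j.-2) ->
  (forall j : nat, (2 <= j <= t.+1)%N ->
      e (w j.-1) (w j) /\ w j != w j.-2) ->
  (forall j : nat, (1 <= j <= t)%N -> deg e (v j) = 2%N /\ deg e (w j) = 2%N) ->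
  (deg e (v t.+1) = 1%N /\ deg e (w t.+1) = 1%N) \/
  (deg e (v t.+1) = 2%N /\ deg e (w t.+1) = 2%N).
Proof.
move=> k3 oddk [[esym eirr] conn _ edges] period _ c_inj c_edge du dc v0 w0 ev ew vw
  v1c t0 vP wP d_arm.
have k0 : 0 < k by apply: leq_trans k3.
have [nxt [d [enxt nxt_c d_c d_nxt nxtP]]] :=
  unicycle_orientation esym k3 c_inj c_edge (conj esym eirr) conn edges.
pose cs := mkseq c k; rewrite -/cs in d_nxt.
have nxt_cs x : x \in cs -> nxt x \in cs := nxt_cs k3 nxt_c (x := x).
have ucs : c 0 \in cs by apply: mem_cs.
have vA : arm e (mem cs) (c 0) t v.
  by split=> //; apply/negP => /csP[i lti E]; have [/eqP] := v1c i lti.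
have wA : arm e (mem cs) (c 0) t w.
  by split=> //; apply/negP => /csP[i lti E]; have [_ /eqP] := v1c i lti.
have out a j : arm e (mem cs) (c 0) t a -> j <= t -> a j.+1 \notin cs.
  by move=> aA lej; have [] := arm_nxt nxtP nxt_cs ucs aA lej.
have inj a i j : arm e (mem cs) (c 0) t a -> i < t.+1 -> j < t.+1 -> a i.+1 = a j.+1 -> i = j.
  by move=> aA lei lej /(arms_eq nxtP nxt_cs ucs aA aA lei lej)[[]].
(* The cycle and the two arms of t + 1 vertices are disjoint, so the characteristic polynomial has
   enough coefficients to reach index k + 2t. *)
have cardT : k + t.*2.+2 <= #|T|.
  pose s := cs ++ mkseq (fun i => v i.+1) t.+1 ++ mkseq (fun i => w i.+1) t.+1.
  have -> : k + t.*2.+2 = size s by rewrite !size_cat !size_mkseq; lia.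
  have uniq_arm a : arm e (mem cs) (c 0) t a -> uniq (mkseq (fun i => a i.+1) t.+1).
    by move=> aA; apply/mkseq_uniqP => i j lti ltj; apply: inj aA lti ltj.
  suff s_uniq : uniq s by rewrite -(card_uniqP s_uniq) max_card.
  rewrite !cat_uniq (uniq_cs c_inj) (uniq_arm v vA) (uniq_arm w wA) !andTb andbT.
  apply/andP; split; apply/hasPn => x.
    rewrite mem_cat => /orP[] /mapP[i]; rewrite mem_iota => lti ->; exact: out.
  case/mapP=> j; rewrite mem_iota => ltj ->; apply/mapP => -[i].
  rewrite mem_iota => lti E; case/eqP: vw.
  by have [_ ->] := arms_eq nxtP nxt_cs ucs vA wA lti ltj (Logic.eq_sym E).
case DT: #|T| cardT => [|n] cardT; first by lia.
pose s (i : 'I_(1 + n)) : T := enum_val (cast_ord (Logic.eq_sym DT) i).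
pose s' x : 'I_(1 + n) := cast_ord DT (enum_rank x).
have sK : cancel s s' by move=> i; rewrite /s' /s enum_valK cast_ordKV.
have s'K : cancel s' s by move=> x; rewrite /s' /s cast_ordK enum_rankK.
(* A transposition moves [u] to index 0. *)
pose tau i := s (tperm (lshift n ord0) (s' (c 0)) i).
have tauB : bijective tau.
  exists (fun x => tperm (lshift n ord0) (s' (c 0)) (s' x)) => [i|x].
    by rewrite /tau sK tpermK.
  by rewrite /tau tpermK s'K.
have tau0 : tau (lshift n ord0) = c 0 by rewrite /tau tpermL.
have deg_gt0 x : 0 < deg e x by apply/card_gt0P; exists (nxt x); apply: enxt.
have chi := char_poly_walk_int tauB esym deg_gt0 period.
have size_V : k + t.*2 < n by lia.
have := arms_end_int k3 oddk esym eirr c_inj c_edge du dc nxt_c d_c d_nxt nxtP vA wA vw t0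
  d_arm tauB tau0 size_V chi.
exact: inv_nat_sum_int.
Qed.
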